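(* The elements $A^iB^jC^k\Omega^\ell\alpha^r\beta^s\gamma^t$ with $i,j,k,\ell,r,s,t\geq 0$ and $ijk=0$ form a basis for the $\mathbb F$-vector space $\Delta$.
   Context: Let $\mathbb F$ be a field and fix a nonzero $q\in\mathbb F$ with $q^4\neq 1$. The universal Askey--Wilson algebra $\Delta$ is the associative $\mathbb F$-algebra with 1 with generators $A,B,C$ subject to the relations that each of $A+\frac{qBC-q^{-1}CB}{q^2-q^{-2}}$, $B+\frac{qCA-q^{-1}AC}{q^2-q^{-2}}$, $C+\frac{qAB-q^{-1}BA}{q^2-q^{-2}}$ is central; $\alpha,\beta,\gamma$ denote these three central elements (in order) each multiplied by $q+q^{-1}$. Let $\Omega = qABC+q^2A^2+q^{-2}B^2+q^2C^2-qA\alpha-q^{-1}B\beta-qC\gamma$. *)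

(* Defs.v *)
From HB Require Import structures.
From mathcomp Require Import all_boot all_order all_algebra.
From mathcomp Require Import monalg.
Set Implicit Arguments. Unset Strict Implicit. Unset Printing Implicit Defensive.
Import GRing.Theory.
Local Open Scope ring_scope.

(* The free associative F-algebra on three generators A, B, C:
   the monoid algebra of the free monoid {fmonom 'I_3}. *)
Definition FreeAlg (F : fieldType) := {malg F[{fmonom 'I_3}]}.

Section AW.
Variables (F : fieldType) (q : F).

Definition gen (i : 'I_3) : FreeAlg F := << fmu i >>.
Definition gA : FreeAlg F := gen 0.
Definition gB : FreeAlg F := gen 1.
Definition gC : FreeAlg F := gen 2.

(* the elements required to be central *)
Definition ctrA : FreeAlg F :=
  gA + (q ^+ 2 - q ^- 2)^-1 *: (q *: (gB * gC) - q^-1 *: (gC * gB)).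
Definition ctrB : FreeAlg F :=
  gB + (q ^+ 2 - q ^- 2)^-1 *: (q *: (gC * gA) - q^-1 *: (gA * gC)).
Definition ctrC : FreeAlg F :=
  gC + (q ^+ 2 - q ^- 2)^-1 *: (q *: (gA * gB) - q^-1 *: (gB * gA)).

Definition alpha : FreeAlg F := (q + q^-1) *: ctrA.
Definition beta  : FreeAlg F := (q + q^-1) *: ctrB.
Definition gamma : FreeAlg F := (q + q^-1) *: ctrC.

Definition Omega : FreeAlg F :=
  q *: (gA * gB * gC) + q ^+ 2 *: (gA * gA) + q ^- 2 *: (gB * gB)
  + q ^+ 2 *: (gC * gC) - q *: (gA * alpha) - q^-1 *: (gB * beta)
  - q *: (gC * gamma).

Definition AW_rels : seq (FreeAlg F) :=
  [seq x * g - g * x | x <- [:: ctrA; ctrB; ctrC], g <- [:: gA; gB; gC]].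

Definition in_AW_ideal (p : FreeAlg F) : Prop :=
  exists s : seq (FreeAlg F * FreeAlg F * FreeAlg F),
    (forall t, t \in s -> t.1.2 \in AW_rels) /\
    p = \sum_(t <- s) t.1.1 * t.1.2 * t.2.

Definition AW_index := (nat * nat * nat * nat * nat * nat * nat)%type.

Definition AW_admissible (e : AW_index) : bool :=
  let: (i, j, k, _, _, _, _) := e in (i * j * k == 0)%N.

Definition AW_mono (e : AW_index) : FreeAlg F :=
  let: (i, j, k, l, r, s, t) := e in
  gA ^+ i * gB ^+ j * gC ^+ k * Omega ^+ l * alpha ^+ r * beta ^+ s * gamma ^+ t.

End AW.

(* Main.v *)
(* Spanning: modulo shorter words the relations allow any two letters of a word in A, B, C
   to be swapped, at the cost of central factors.  So a word can be sorted to A^i B^j C^k, and if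
   ijk <> 0 it can be rearranged to end in ABC, which Omega expresses by shorter words.

   Independence: Delta acts on functions on Z^6 through a homomorphism to the quantum torus
   with letters Lambda, a, b, c, e, y, where y e = q^2 e y and all other pairs commute.  It sends
   alpha to Lambda (a + a^-1) + (b + b^-1) (c + c^-1), and beta, gamma to its cyclic images.
   For a suitable weight every generator has a single top monomial: a e, b y,
   Lambda c e^-1 y^-1 for A, B, C; Lambda a b c for Omega; Lambda a, Lambda b, Lambda c for
   alpha, beta, gamma.  The products of these attached to the exponents with ijk = 0 are
   pairwise distinct, whether or not q is a root of unity. *)

Require Import Defs.
From HB Require Import structures.
From mathcomp Require Import all_boot all_order all_algebra.
From mathcomp Require Import finmap monalg zify ring.
Import Order.TTheory GRing.Theory Num.Theory.
Local Open Scope ring_scope.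

(** By induction on [t]: its head is located in [s] and carried to the front by adjacent swaps; the
    rest is the induction hypothesis for the predicate [P (x :: _)]. *)
Lemma perm_eq_swap_ind (T : eqType) (P : seq T -> Prop) :
  (forall u x y v, P (u ++ x :: y :: v) -> P (u ++ y :: x :: v)) ->
  forall s t, perm_eq s t -> P s -> P t.
Proof.
move=> Pswap s t; elim: t P Pswap s => [|x t IHt] P Pswap s.
  by move=> /perm_nilP->.
move=> eq_st.
have /splitPr sx : x \in s by rewrite (perm_mem eq_st) mem_head.
case: sx eq_st => u v eq_st Ps.
have {}Ps : P (x :: u ++ v).
  elim/last_ind: u v {eq_st} Ps => [|u y IHu] v //.
  by rewrite cat_rcons => /Pswap /IHu; rewrite cat_rcons.
apply: (IHt (fun w => P (x :: w)) _ _ _ Ps) => [w y z w'|].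
  exact: (Pswap (x :: w)).
rewrite -(perm_cons x); apply: perm_trans eq_st.
by rewrite perm_sym -[x :: v]cat1s perm_catCA.
Qed.

(** * Spanning modulo an ideal, from swap rules and central elements *)

Section Spanning.

Variables (F : fieldType) (R : lalgType F).
Hypothesis mulrZ : forall (k : F) (x y : R), k *: (x * y) = x * (k *: y).

(** The quotient is never formed: [I] is the ideal, and congruences are memberships of
    differences. *)
Variable I : R -> Prop.
Hypotheses (I0 : I 0) (ID : forall x y, I x -> I y -> I (x + y))
  (IZ : forall k x, I x -> I (k *: x))
  (IMl : forall x y, I y -> I (x * y)) (IMr : forall x y, I x -> I (x * y)).

Variables (G a : 'I_3 -> R) (Om : R).

Definition word (w : seq 'I_3) : R := \prod_(i <- w) G i.

Definition abs_mono (e : AW_index) : R :=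
  let: (i, j, k, l, r, s, t) := e in
  G 0 ^+ i * G 1 ^+ j * G 2 ^+ k * Om ^+ l * a 0 ^+ r * a 1 ^+ s * a 2 ^+ t.

Hypothesis words_span : forall p : R,
  exists s : seq (F * seq 'I_3), p = \sum_(x <- s) x.1 *: word x.2.
(** Centrality holds modulo [I]. The next two hypotheses are exact identities in the free algebra,
    because the central elements and Omega are defined there as expressions in A, B, C. *)
Hypothesis G_central : forall i j, I (a i * G j - G j * a i).
Hypothesis G_swap : forall i j, i != j -> exists (c d e : F) k,
  G i * G j = c *: (G j * G i) + d *: a k + e *: G k.
Hypothesis G_Om : exists (c : F) (d e : 'I_3 -> F),
  G 0 * G 1 * G 2 =
  c *: Om + \sum_i (d i *: (G i * G i) + e i *: (G i * a i)).

Definition spanned (p : R) : Prop :=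
  exists s : seq (F * AW_index), (forall x, x \in s -> AW_admissible x.2) /\
    I (p - \sum_(x <- s) x.1 *: abs_mono x.2).

Lemma spanned_congr p p' : I (p - p') -> spanned p' -> spanned p.
Proof.
move=> Ipp' [s [sP Is]]; exists s; split=> //.
by rewrite -(subrKA p'); apply: ID.
Qed.

Lemma spanned0 : spanned 0.
Proof. by exists [::]; split=> //; rewrite big_nil subr0. Qed.

Lemma spannedD p p' : spanned p -> spanned p' -> spanned (p + p').
Proof.
move=> [s [sP Is]] [t [tP It]]; exists (s ++ t); split=> [x|].
  by rewrite mem_cat => /orP[/sP|/tP].
by rewrite big_cat opprD addrACA; apply: ID.
Qed.

Lemma spannedZ k p : spanned p -> spanned (k *: p).
Proof.
move=> [s [sP Is]]; exists [seq (k * x.1, x.2) | x <- s]; split=> [x|].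
  by case/mapP=> y /sP ? ->.
rewrite big_map (eq_bigr (fun x => k *: (x.1 *: abs_mono x.2))) => [|x _].
  by rewrite -scaler_sumr -scalerBr; apply: IZ.
by rewrite scalerA.
Qed.

Lemma spanned_sum (T : Type) (s : seq T) (f : T -> R) :
  (forall x, spanned (f x)) -> spanned (\sum_(x <- s) f x).
Proof. by move=> fP; apply: (big_ind spanned) => //; [apply: spanned0|apply: spannedD]. Qed.

Lemma spanned_abs_mono e : AW_admissible e -> spanned (abs_mono e).
Proof.
move=> eP; exists [:: (1, e)]; split=> [x|]; first by rewrite inE => /eqP->.
by rewrite big_seq1 scale1r subrr.
Qed.

Definition comm_mod (x y : R) := I (x * y - y * x).

Lemma comm_modM x y z : comm_mod x y -> comm_mod x z -> comm_mod x (y * z).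
Proof.
rewrite /comm_mod => Ixy Ixz.
have -> : x * (y * z) - y * z * x = (x * y - y * x) * z + y * (x * z - z * x).
  by rewrite mulrBl mulrBr !mulrA subrKA.
by apply: ID; [apply: IMr|apply: IMl].
Qed.

(** Commutation with the generators passes to words by the Leibniz rule for commutators, then to all
    elements by linearity. *)
Lemma a_central i x : comm_mod (a i) x.
Proof.
have [s ->] := words_span x; apply: (big_ind (comm_mod (a i))) => [|y z Iy Iz|c _].
- by rewrite /comm_mod mulr0 mul0r subrr.
- by rewrite /comm_mod mulrDl mulrDr opprD addrACA; apply: ID.
rewrite /comm_mod -scalerAl -mulrZ -scalerBr; apply: IZ.
apply: (big_ind (comm_mod (a i))) => [|y z Iy Iz|j _]; last exact: G_central.
- by rewrite /comm_mod mulr1 mul1r subrr.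
- exact: comm_modM.
Qed.

(** [Om] stands first so that an [Om] produced at the end of a word is absorbed at once. *)
Definition tail (l r s t : nat) : R :=
  Om ^+ l * a 0 ^+ r * a 1 ^+ s * a 2 ^+ t.

Lemma tail_absorb i l r s t : exists r' s' t', I (a i * tail l r s t - tail l r' s' t').
Proof.
rewrite /tail.
case: i => [[|[|[|//]]] Hi].
- have -> : Ordinal Hi = 0 by apply: val_inj.
  exists r.+1, s, t; rewrite exprS !mulrA -!mulrBl.
  by do 3 apply: IMr; apply: a_central.
- have -> : Ordinal Hi = 1 by apply: val_inj.
  exists r, s.+1, t; rewrite exprS !mulrA -!mulrBl; do 2 apply: IMr.
  by rewrite -[a 1 * _ * _]mulrA; apply: a_central.
- have -> : Ordinal Hi = 2 by apply: val_inj.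
  exists r, s, t.+1; rewrite exprS !mulrA -!mulrBl; apply: IMr.
  by rewrite -2![a 2 * _ * _]mulrA; apply: a_central.
Qed.

(** All tails are allowed, since rewriting a word sends factors into its tail. *)
Definition spans (w : seq 'I_3) :=
  forall l r s t, spanned (word w * tail l r s t).

Lemma word_cat u v : word (u ++ v) = word u * word v.
Proof. exact: big_cat. Qed.

Lemma spans_a_mid u v i : spans (u ++ v) ->
  forall l r s t, spanned (word u * a i * word v * tail l r s t).
Proof.
move=> uvP l r s t; have [r' [s' [t' Ii]]] := tail_absorb i l r s t.
move: (tail l r s t) Ii => T Ii.
apply: (spanned_congr _ _ _ (uvP l r' s' t')).
rewrite -(subrKA (word u * word v * (a i * T))) word_cat.
apply: ID; last by rewrite -mulrBr; apply: IMl.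
rewrite !mulrA -mulrBl; apply: IMr; rewrite -!mulrA -mulrBr; apply: IMl.
exact: a_central.
Qed.

Lemma wordE2 u i j v : word (u ++ i :: j :: v) = word u * (G i * G j) * word v.
Proof. by rewrite word_cat /word !big_cons !mulrA. Qed.

Lemma wordE1 u i v : word (u ++ i :: v) = word u * G i * word v.
Proof. by rewrite word_cat /word !big_cons !mulrA. Qed.

(** The swap rule leaves two error terms: a central element, with a word shorter by two, and a
    single letter, with a word shorter by one. *)
Lemma spans_swap u i j v :
  (forall w, (size w < size (u ++ j :: i :: v))%N -> spans w) ->
  spans (u ++ j :: i :: v) -> spans (u ++ i :: j :: v).
Proof.
move=> short; have [->//|neq_ij] := eqVneq i j.
have [c [d [e [k Gij]]]] := G_swap _ _ neq_ij.
move=> jiP l r s t; rewrite wordE2 Gij !(mulrDr, mulrDl) -!mulrZ -!scalerAl.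
apply: spannedD; first apply: spannedD; apply: spannedZ.
- by rewrite -wordE2; apply: jiP.
- by apply: spans_a_mid; apply: short; rewrite !size_cat ltn_add2l /= ltnW.
- by rewrite -wordE1; apply: short; rewrite !size_cat ltn_add2l /=.
Qed.

Lemma spans_perm n s t :
  (forall w, (size w < n)%N -> spans w) -> size s = n ->
  perm_eq s t -> spans s -> spans t.
Proof.
move=> short; pose P w := size w = n /\ spans w.
move=> size_s eq_st Ps; suff [] : P t by [].
apply: (perm_eq_swap_ind _ P _ _ _ eq_st) => // u x y v [size_w wP].
by split; [rewrite -size_w !size_cat|apply: spans_swap => // w; rewrite size_w; apply: short].
Qed.

(** Solving Omega for ABC leaves at most two letters after [u], so every resulting word is
    shorter. *)
Lemma spans_Om u : (forall w, (size w < size u + 3)%N -> spans w) ->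
  spans (u ++ [:: 0; 1; 2]).
Proof.
move=> short l r s t; have [c [d [e GOm]]] := G_Om.
have -> : word (u ++ [:: 0; 1; 2]) = word u * (G 0 * G 1 * G 2).
  by rewrite word_cat /word !big_cons big_nil mulr1 !mulrA.
rewrite GOm mulrDr mulrDl -!mulrZ -!scalerAl; apply: spannedD.
  apply: spannedZ.
  have -> : word u * Om * tail l r s t = word u * tail l.+1 r s t.
    by rewrite /tail exprS !mulrA.
  by apply: short; rewrite -addn1 leq_add2l.
rewrite mulr_sumr mulr_suml; apply: spanned_sum => i.
rewrite mulrDr mulrDl -!mulrZ -!scalerAl; apply: spannedD; apply: spannedZ.
  have -> : word u * (G i * G i) = word (u ++ [:: i; i]).
    by rewrite wordE2 /word big_nil mulr1.
  by apply: short; rewrite size_cat ltn_add2l.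
have -> : word u * (G i * a i) = word (u ++ [:: i]) * a i * word [::].
  by rewrite wordE1 /word big_nil !mulr1 mulrA.
by apply: spans_a_mid; apply: short; rewrite cats0 size_cat ltn_add2l.
Qed.

Definition sorted_word i j k : seq 'I_3 := nseq i 0 ++ nseq j 1 ++ nseq k 2.

Lemma word_nseq i x : word (nseq i x) = G x ^+ i.
Proof.
elim: i => [|i IHi]; first exact: big_nil.
by rewrite exprS -IHi; exact: big_cons.
Qed.

Lemma perm_sorted_word (w : seq 'I_3) :
  exists i j k, perm_eq w (sorted_word i j k).
Proof.
exists (count_mem 0 w), (count_mem 1 w), (count_mem 2 w).
apply/allP => x _; apply/eqP; rewrite !count_cat !count_nseq /=.
by case: x => [[|[|[|//]]] Hx]; rewrite /= ?mul1n ?mul0n ?addn0 ?add0n;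
  apply: eq_count => y /=; rewrite -!val_eqE.
Qed.

Lemma spans_word w : spans w.
Proof.
have [n] := ubnP (size w); elim: n w => // n IHn w; rewrite ltnS => le_wn.
have {le_wn IHn}IH w' : (size w' < size w)%N -> spans w'.
  by move=> lt_w'w; apply/IHn/(leq_trans lt_w'w).
have [i [j [k eq_w]]] := perm_sorted_word w.
have size_w := perm_size eq_w.
case: (posnP (i * j * k)) => [ijk0|].
  apply: (spans_perm _ (sorted_word i j k) w IH); [by []|by rewrite perm_sym|].
  move=> l r s t; rewrite !word_cat !word_nseq /tail !mulrA.
  by apply: (spanned_abs_mono (i, j, k, l, r, s, t)); rewrite /= ijk0.
case: i eq_w size_w => [|i] // eq_w size_w.
case: j eq_w size_w => [|j] eq_w size_w; first by rewrite muln0.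
case: k eq_w size_w => [|k] eq_w size_w; first by rewrite muln0.
(* Here [i], [j], [k] are one less than the letter counts; the spare letters go to the end as
   ABC. *)
move=> _; pose v := sorted_word i j k ++ [:: 0; 1; 2].
have eq_v : perm_eq v w.
  rewrite perm_sym; apply: (perm_trans eq_w); apply/allP => x _; apply/eqP.
  by rewrite !count_cat !count_nseq /=; lia.
have size_v := perm_size eq_v.
apply: (spans_perm _ _ _ IH size_v eq_v).
by apply: spans_Om => w'; rewrite -[3%N]/(size [:: 0; 1; 2 : 'I_3]) -size_cat size_v; apply: IH.
Qed.

Lemma spanned_all p : spanned p.
Proof.
have [s ->] := words_span p; apply: spanned_sum => x; apply: spannedZ.
by have := spans_word x.2 0 0 0 0; rewrite /tail !expr0 !mulr1.
Qed.

End Spanning.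

(** * Monoid algebras, generated ideals and the free algebra *)

Section MonoidAlgebra.
Variables (F : fieldType) (M : monomType).

Lemma malgZU (k : F) (m : M) : k *: (<< m >> : {malg F[M]}) = << k *g m >>.
Proof. by apply/malgP => m'; rewrite mcoeffZ !mcoeffU mulrnAr mulr1. Qed.

(** A constant sits at the unit monomial and [F] is commutative, so constants are central. *)
Lemma malg_scalerAr (k : F) (x y : {malg F[M]}) : k *: (x * y) = x * (k *: y).
Proof.
rewrite -!mul_malgC mulrA [RHS]mulrA; congr (_ * _).
rewrite !malgM_def fgmulUg fgmulgU; apply: eq_bigr => m _.
by rewrite mulrC mulm1 mul1m.
Qed.

Lemma malgUM (m n : M) : << mmul m n >> = << m >> * << n >> :> {malg F[M]}.
Proof. by rewrite malgM_def fgmulUU mulr1. Qed.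

End MonoidAlgebra.

Section GeneratedIdeal.
Variables (F : fieldType) (R : lalgType F) (rels : seq R).

(** [in_AW_ideal q] is convertible to the instance at [AW_rels q]. *)
Definition ideal_gen (p : R) : Prop :=
  exists s : seq (R * R * R),
    (forall t, t \in s -> t.1.2 \in rels) /\
    p = \sum_(t <- s) t.1.1 * t.1.2 * t.2.

Local Notation I := ideal_gen.

Lemma ideal_gen0 : I 0.
Proof. by exists [::]; rewrite big_nil. Qed.

Lemma ideal_genD x y : I x -> I y -> I (x + y).
Proof.
move=> [s [sP ->]] [t [tP ->]]; exists (s ++ t); rewrite big_cat; split=> // z.
by rewrite mem_cat => /orP[/sP|/tP].
Qed.

Lemma ideal_genMl x y : I y -> I (x * y).
Proof.
move=> [s [sP ->]]; exists [seq (x * t.1.1, t.1.2, t.2) | t <- s]; split.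
  by move=> t /mapP[u /sP su ->].
by rewrite big_map mulr_sumr; apply: eq_bigr => t _; rewrite !mulrA.
Qed.

Lemma ideal_genMr x y : I x -> I (x * y).
Proof.
move=> [s [sP ->]]; exists [seq (t.1.1, t.1.2, t.2 * y) | t <- s]; split.
  by move=> t /mapP[u /sP su ->].
by rewrite big_map mulr_suml; apply: eq_bigr => t _; rewrite !mulrA.
Qed.

Lemma ideal_genZ k x : I x -> I (k *: x).
Proof. by move=> Ix; rewrite -[x]mul1r scalerAl; apply: ideal_genMl. Qed.

Lemma ideal_gen_rel x : x \in rels -> I x.
Proof.
move=> xP; exists [:: (1, x, 1)]; split=> [t|]; first by rewrite inE => /eqP->.
by rewrite big_seq1 mul1r mulr1.
Qed.

End GeneratedIdeal.

(** The scalar [k] accounts for the factor q + q^-1 between [ctrA], which occurs in the relations,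
    and [alpha]. *)
Lemma ideal_gen_comm (F : fieldType) (R : lalgType F) (xs gs : seq R) (k : F) x g :
  (forall (k : F) (x y : R), k *: (x * y) = x * (k *: y)) ->
  x \in xs -> g \in gs ->
  ideal_gen F R [seq x * g - g * x | x <- xs, g <- gs]
    ((k *: x) * g - g * (k *: x)).
Proof.
move=> mulrZ xP gP; rewrite -scalerAl -mulrZ -scalerBr.
by apply/ideal_genZ/ideal_gen_rel/allpairs_f.
Qed.

Section FreeAlgebra.
Variable F : fieldType.
Implicit Types (x y p : FreeAlg F).

Lemma monalgU_word (m : {fmonom 'I_3}) :
  << m >> = word F (FreeAlg F) (gen F) (fmonom_val m).
Proof.
case: m => w; elim: w => [|i w IHw].
  by rewrite /word big_nil -fmoneE.
rewrite /word big_cons -[bigop _ _ _]/(word _ _ _ w) -IHw /gen.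
rewrite -malgUM; congr << _ >>.
by apply/eqP; rewrite fmP fmM fmU.
Qed.

Lemma FreeAlg_words_span p : exists s : seq (F * seq 'I_3),
  p = \sum_(x <- s) x.1 *: word F (FreeAlg F) (gen F) x.2.
Proof.
exists [seq (p@_m, fmonom_val m) | m <- enum_fset (msupp p)].
rewrite big_map [LHS]monalgE; apply: eq_bigr => m _.
by rewrite -monalgU_word malgZU.
Qed.

End FreeAlgebra.

Lemma mem_seq3 (T : eqType) (x y z : T) :
  [/\ x \in [:: x; y; z], y \in [:: x; y; z] & z \in [:: x; y; z]].
Proof. by rewrite !inE !eqxx !orbT. Qed.

(** * Spanning for the universal Askey-Wilson algebra *)

Section AskeyWilson.
Variables (F : fieldType) (q : F).
Local Notation I := (in_AW_ideal q).

Let o0 H : @Ordinal 3 0 H = 0. Proof. exact: val_inj. Qed.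
Let o1 H : @Ordinal 3 1 H = 1. Proof. exact: val_inj. Qed.
Let o2 H : @Ordinal 3 2 H = 2. Proof. exact: val_inj. Qed.

Definition centrals (i : 'I_3) : FreeAlg F := nth 0 [:: alpha q; beta q; gamma q] i.

Lemma centrals_central i j :
  in_AW_ideal q (centrals i * gen F j - gen F j * centrals i).
Proof.
have gP : gen F j \in [:: gA F; gB F; gC F].
  apply: (map_f (gen F) (_ : j \in [:: 0; 1; 2])).
  by clear; case: j => [[|[|[|]]]].
have [ctrA_in ctrB_in ctrC_in] := mem_seq3 _ (ctrA q) (ctrB q) (ctrC q).
have abcP : exists2 x, centrals i = (q + q^-1) *: x & x \in [:: ctrA q; ctrB q; ctrC q].
  by case: i => [[|[|[|//]]] Hi]; [exact: (ex_intro2 _ _ (ctrA q) erefl ctrA_in)|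
    exact: (ex_intro2 _ _ (ctrB q) erefl ctrB_in)|exact: (ex_intro2 _ _ (ctrC q) erefl ctrC_in)].
case: abcP => x -> xP.
exact: (ideal_gen_comm F (FreeAlg F) _ _ _ x _ (@malg_scalerAr F _) xP gP).
Qed.

Hypotheses (hq0 : q != 0) (hq4 : q ^+ 4 != 1).

(** Vanishing would give q^2 = -1, hence q^4 = 1. *)
Lemma qDVq_neq0 : q + q^-1 != 0.
Proof.
apply: contra hq4 => /eqP qq; have : (q + q^-1) * q = 0 by rewrite qq mul0r.
rewrite mulrDl mulVf // => /eqP; rewrite addr_eq0 => /eqP q2.
by rewrite -[4%N]/(2 * 2)%N exprM -[q ^+ 2]/(q * q) q2 sqrrN expr1n.
Qed.

Lemma q2BVq2_neq0 : q ^+ 2 - q ^- 2 != 0.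
Proof.
apply: contra hq4; rewrite subr_eq0 => /eqP q2.
by rewrite -[4%N]/(2 + 2)%N exprD {1}q2 mulVf // expf_neq0.
Qed.

(** With [u] = BC and [v] = CB, the definition of alpha is solved for either product, giving both
    directions of the swap. *)
Lemma swap_rule (V : lmodType F) (x u v : V) (D s : F) : D != 0 -> s != 0 ->
  let al := s *: (x + D^-1 *: (q *: u - q^-1 *: v)) in
  (u = q^-1 ^+ 2 *: v + (q^-1 * D * s^-1) *: al + - (q^-1 * D) *: x) *
  (v = q ^+ 2 *: u + - (q * D * s^-1) *: al + (q * D) *: x).
Proof.
move=> D0 s0 al; have : q *: u - q^-1 *: v = D *: (s^-1 *: al - x).
  by rewrite /al scalerA mulVf // scale1r [x + _]addrC addrK scalerA mulfV // scale1r.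
rewrite scalerBr scalerA; move: {al}(al) => al /eqP.
rewrite subr_eq => /eqP qu; split.
  have -> : u = q^-1 *: (q *: u) by rewrite scalerA mulVf // scale1r.
  by rewrite qu !(scalerDr, scalerN) !scalerA expr2 scaleNr !mulrA addrC addrA.
have -> : v = q *: (q^-1 *: v) by rewrite scalerA mulfV // scale1r.
have -> : q^-1 *: v = q *: u - ((D * s^-1) *: al - D *: x) by rewrite qu addrC addKr.
by rewrite !(scalerDr, scalerN) opprB !scalerA !scaleNr !mulrA expr2 addrA addrAC.
Qed.

Lemma gen_swap i j : i != j -> exists (c d e : F) k,
  gen F i * gen F j = c *: (gen F j * gen F i) + d *: centrals k + e *: gen F k.
Proof.
move: i j; have sw x u v := swap_rule (FreeAlg F) x u v _ _ q2BVq2_neq0 qDVq_neq0.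
have [[swA swB] swC] := (sw (gA F) (gB F * gC F) (gC F * gB F),
  sw (gB F) (gC F * gA F) (gA F * gC F), sw (gC F) (gA F * gB F) (gB F * gA F)).
move=> [[|[|[|?]]] Hi] [[|[|[|?]]] Hj] neq_ij;
  try solve [by case/negP: neq_ij|by case: (Hi)|by case: (Hj)];
  rewrite ?o0 ?o1 ?o2 {neq_ij}.
(* The letter missing from the pair selects the relation; the component selects its direction. *)
- by do 3 eexists; exists 2; apply: (swC.1).
- by do 3 eexists; exists 1; apply: (swB.2).
- by do 3 eexists; exists 2; apply: (swC.2).
- by do 3 eexists; exists 0; apply: (swA.1).
- by do 3 eexists; exists 1; apply: (swB.1).
- by do 3 eexists; exists 0; apply: (swA.2).
Qed.

(** For [p] = ABC, [u] the squares of the generators and [v] their products with the central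
    elements, the parenthesis is Omega. *)
Lemma solve_Omega (V : lmodType F) (p : V) (u v : 'I_3 -> V) :
  p = q^-1 *: (q *: p + q ^+ 2 *: u 0 + q ^- 2 *: u 1 + q ^+ 2 *: u 2
               - q *: v 0 - q^-1 *: v 1 - q *: v 2) +
    \sum_(i < 3) ((- (q^-1 * nth 0 [:: q ^+ 2; q ^- 2; q ^+ 2] i)) *: u i +
            (q^-1 * nth 0 [:: q; q^-1; q] i) *: v i).
Proof.
rewrite -[LHS]scale1r -{1}(mulVf hq0) -scalerA.
under eq_bigr do rewrite scaleNr -!scalerA -scalerN -scalerDr.
rewrite -scaler_sumr -scalerDr; congr (_ *: _).
rewrite !big_ord_recl big_ord0 addr0 /=.
have -> : lift ord0 ord0 = 1 :> 'I_3 by apply: val_inj.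
have -> : lift ord0 (lift ord0 ord0) = 2 :> 'I_3 by apply: val_inj.
rewrite -[ord0]/(0 : 'I_3).
move: (q *: p) (q ^+ 2 *: u 0) (_ *: u 1) (_ *: u 2) (_ *: v 0) (_ *: v 1) (_ *: v 2).
move=> x1 x2 x3 x4 x5 x6 x7.
(* The permutation puts each term other than the first next to its opposite. *)
rewrite !addrA [RHS](ACl (1 * (2 * 8) * (3 * 10) * (4 * 12) * (5 * 9) * (6 * 11) * (7 * 13)))%AC.
by rewrite /= !(subrr, addNr) !addr0.
Qed.

Lemma gen_Omega : exists (c : F) (d e : 'I_3 -> F),
  gen F 0 * gen F 1 * gen F 2 =
  c *: Omega q +
  \sum_i (d i *: (gen F i * gen F i) + e i *: (gen F i * centrals i)).
Proof.
do 3 eexists.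
exact: (solve_Omega (FreeAlg F) _ (fun i => gen F i * gen F i)
  (fun i => gen F i * centrals i)).
Qed.

Theorem AW_mono_span (p : FreeAlg F) : exists s : seq (F * AW_index),
  (forall x, x \in s -> AW_admissible x.2) /\
  in_AW_ideal q (p - \sum_(x <- s) x.1 *: AW_mono q x.2).
Proof.
have [s [sP Is]] := spanned_all F (FreeAlg F) (@malg_scalerAr F _) I
  (ideal_gen0 _ _ _) (ideal_genD _ _ _) (ideal_genZ _ _ _)
  (ideal_genMl _ _ _) (ideal_genMr _ _ _)
  (gen F) centrals (Omega q) (@FreeAlg_words_span F) centrals_central gen_swap gen_Omega p.
exists s; split=> //; congr (I (_ - _)): Is.
Qed.
End AskeyWilson.

(** * Actions of a monoid algebra on functions *)

Section MonoidRepresentation.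
Variables (F : fieldType) (M : monomType) (T : Type).
Variable act : M -> (T -> F) -> T -> F.
Hypotheses
  (act_ext : forall m f g, f =1 g -> act m f =1 act m g)
  (actM : forall m n f, act (mmul m n) f =1 act m (act n f))
  (act1 : forall f, act mone f =1 f)
  (act_sum : forall m (s : seq M) (c : M -> F) (f : M -> T -> F) w,
    act m (fun u => \sum_(x <- s) c x * f x u) w = \sum_(x <- s) c x * act m (f x) w).

(** Linear extension of the monoid action. Functions are compared pointwise, whence the hypothesis
    [act_ext]. *)
Definition malg_act (p : {malg F[M]}) (f : T -> F) (w : T) : F :=
  \sum_(m <- msupp p) p@_m * act m f w.

Lemma malg_actEw (d : {fset M}) p f w : fsubset (msupp p) d ->
  malg_act p f w = \sum_(m <- d) p@_m * act m f w.
Proof.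
move=> le_pd; rewrite /malg_act (big_fset_incl _ le_pd) //= => m _.
by move/mcoeff_outdom->; rewrite mul0r.
Qed.

Lemma malg_act0 f w : malg_act 0 f w = 0.
Proof. by rewrite /malg_act msupp0 big_seq_fset0. Qed.

Lemma malg_actD p p' f w : malg_act (p + p') f w = malg_act p f w + malg_act p' f w.
Proof.
rewrite (malg_actEw (fsetU (msupp p) (msupp p'))) ?msuppD_le //.
rewrite (malg_actEw (fsetU (msupp p) (msupp p')) p) ?fsubsetUl //.
rewrite (malg_actEw (fsetU (msupp p) (msupp p')) p') ?fsubsetUr //.
by rewrite -big_split; apply: eq_bigr => m _; rewrite mcoeffD mulrDl.
Qed.

Lemma malg_actZ k p f w : malg_act (k *: p) f w = k * malg_act p f w.
Proof.
rewrite (malg_actEw (msupp p)) ?msuppZ_le // mulr_sumr.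
by apply: eq_bigr => m _; rewrite mcoeffZ mulrA.
Qed.

Lemma malg_actN p f w : malg_act (- p) f w = - malg_act p f w.
Proof. by rewrite -scaleN1r malg_actZ mulN1r. Qed.

Lemma malg_act_sum (I : Type) (s : seq I) (g : I -> {malg F[M]}) f w :
  malg_act (\sum_(i <- s) g i) f w = \sum_(i <- s) malg_act (g i) f w.
Proof.
elim: s => [|i s IHs]; first by rewrite !big_nil malg_act0.
by rewrite !big_cons malg_actD IHs.
Qed.

Lemma malg_actU k m f w : malg_act << k *g m >> f w = k * act m f w.
Proof. by rewrite (malg_actEw _ _ _ _ msuppU_le) big_seq_fset1 mcoeffUU. Qed.

Lemma malg_act_ext p f g : f =1 g -> malg_act p f =1 malg_act p g.
Proof. by move=> fg w; apply: eq_bigr => m _; rewrite (act_ext m _ _ fg). Qed.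

Lemma malg_act_1 f : malg_act 1 f =1 f.
Proof. by move=> w; rewrite malg_actU mul1r act1. Qed.

Lemma malg_actM p p' f : malg_act (p * p') f =1 malg_act p (malg_act p' f).
Proof.
move=> w; rewrite malgME malg_act_sum; apply: eq_bigr => m _.
rewrite malg_act_sum [X in _ * X]act_sum mulr_sumr; apply: eq_bigr => n _.
by rewrite malg_actU actM mulrA.
Qed.

Lemma malg_act_ideal (rels : seq {malg F[M]}) p f w :
  (forall r g u, r \in rels -> malg_act r g u = 0) ->
  ideal_gen F {malg F[M]} rels p -> malg_act p f w = 0.
Proof.
move=> rels0 [s [sP ->]]; rewrite malg_act_sum big_seq big1 // => t /sP tP.
rewrite malg_actM malg_actM.
have /malg_act_ext -> : malg_act t.1.2 (malg_act t.2 f) =1 (fun=> 0).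
  by move=> u; apply: rels0.
rewrite /malg_act big1 // => m _.
(* Writing zero as an empty sum lets [act_sum] show that the action sends it to zero. *)
have sum0 : (fun=> 0) =1 (fun u : T => \sum_(x <- [::] : seq M) 1 * (0 : F)).
  by move=> u; rewrite big_nil.
by rewrite (act_ext m _ _ sum0) (act_sum m [::] (fun=> 1) (fun _ _ => 0)) big_nil mulr0.
Qed.

End MonoidRepresentation.

(** * The quantum torus acting on functions on Z^6 *)

Section LaurentOperators.

(* Exponents of Lambda, a, b, c, e, y in a monomial of the quantum torus. *)
Definition expo := (int * int * int * int * int * int)%type.

(** A term (n, (p, v)) stands for n q^p X^v, repetitions allowed. Integer coefficients and a formal
    q make identities checkable by computation. *)
Definition lpoly := seq (int * (int * expo)).

Definition e_deg (v : expo) : int := v.1.2.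
Definition y_deg (v : expo) : int := v.2.

Definition qmon (n p i a b c e y : int) : int * (int * expo) :=
  (n, (p, (i, a, b, c, e, y))).

Definition lscale (n p : int) (L : lpoly) : lpoly :=
  [seq (n * t.1, (p + t.2.1, t.2.2)) | t <- L].

(* Multiplication in the torus with y e = q^2 e y, all other pairs of letters commuting. *)
Definition lmul (L L' : lpoly) : lpoly :=
  [seq (t.1 * t'.1, (t.2.1 + t'.2.1 + 2 * y_deg t.2.2 * e_deg t'.2.2, t.2.2 + t'.2.2))
  | t <- L, t' <- L'].

Definition key_coef (k : int * expo) (L : lpoly) : int :=
  foldr (fun t n => if t.2 == k then t.1 + n else n) 0 L.

(** Distinct powers of q count as independent, so a positive answer is valid for every nonzero q. *)
Definition lzero (L : lpoly) : bool := all (fun t => key_coef t.2 L == 0) L.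

Definition lpoly_eq (L L' : lpoly) : bool := lzero (L ++ lscale (-1) 0 L').

Variables (F : fieldType) (q : F).
Hypothesis hq0 : q != 0.

(** Left multiplication by [L] on formal series with coefficients f(u) at X^u, read at X^w. The
    extra power of q comes from moving the y of the term past the e of X^(w - v). *)
Definition lop (L : lpoly) (f : expo -> F) (w : expo) : F :=
  \sum_(t <- L) t.1%:~R * (q ^ (t.2.1 + 2 * y_deg t.2.2 * (e_deg w - e_deg t.2.2))
                          * f (w - t.2.2)).

Lemma lop_ext L f g : f =1 g -> lop L f =1 lop L g.
Proof. by move=> fg w; apply: eq_bigr => t _; rewrite fg. Qed.

Lemma lop_sum L (I : Type) (s : seq I) (c : I -> F) (f : I -> expo -> F) w :
  lop L (fun u => \sum_(x <- s) c x * f x u) w = \sum_(x <- s) c x * lop L (f x) w.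
Proof.
under [RHS]eq_bigr do rewrite mulr_sumr.
rewrite exchange_big; apply: eq_bigr => t _; rewrite !mulr_sumr.
by apply: eq_bigr => x _; ring.
Qed.

Lemma lopZ L k f w : lop L (fun u => k * f u) w = k * lop L f w.
Proof. by rewrite /lop mulr_sumr; apply: eq_bigr => t _; ring. Qed.

Lemma lop_cat L L' f w : lop (L ++ L') f w = lop L f w + lop L' f w.
Proof. exact: big_cat. Qed.

Lemma lop_scale n p L f w : lop (lscale n p L) f w = n%:~R * q ^ p * lop L f w.
Proof.
rewrite /lop big_map mulr_sumr; apply: eq_bigr => t _ /=.
by rewrite -addrA [q ^ (p + _)]expfzDr // intrM -[q ^ p * _ * _]mulrA mulrACA.
Qed.

Lemma lop_mul L L' f w : lop (lmul L L') f w = lop L (lop L' f) w.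
Proof.
rewrite /lop big_allpairs_dep; apply: eq_bigr => t _.
rewrite !mulr_sumr; apply: eq_bigr => t' _ /=.
rewrite intrM.
(* The cocycle identity behind associativity of the torus product. *)
have -> : t.2.1 + t'.2.1 + 2 * y_deg t.2.2 * e_deg t'.2.2 +
    2 * y_deg (t.2.2 + t'.2.2) * (e_deg w - e_deg (t.2.2 + t'.2.2)) =
  t.2.1 + 2 * y_deg t.2.2 * (e_deg w - e_deg t.2.2) +
  (t'.2.1 + 2 * y_deg t'.2.2 * (e_deg (w - t.2.2) - e_deg t'.2.2)).
  by rewrite /y_deg /e_deg /=; ring.
rewrite [q ^ (t.2.1 + _ + _)]expfzDr // [- (t.2.2 + _)]opprD [w + (_ - _)]addrA.
by rewrite -!mulrA; congr (_ * _); rewrite mulrCA.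
Qed.

Lemma key_coefE k L : key_coef k L = \sum_(t <- L | t.2 == k) t.1.
Proof. by elim: L => [|t L IHL] /=; rewrite ?big_nil // big_cons IHL. Qed.

Lemma lop_zero L f w : lzero L -> lop L f w = 0.
Proof.
move=> /allP L0; rewrite /lop.
pose g (k : int * expo) := q ^ (k.1 + 2 * y_deg k.2 * (e_deg w - e_deg k.2)) * f (w - k.2).
(* Each term is spread over the distinct keys, with only its own contributing; exchanging the sums
   collects coefficients by key. *)
transitivity (\sum_(t <- L) \sum_(k <- undup (unzip2 L) | t.2 == k) t.1%:~R * g k).
  apply: eq_big_seq => t tL.
  rewrite big_mkcond (bigD1_seq t.2) ?undup_uniq ?mem_undup ?map_f //= eqxx.
  by rewrite big1 ?addr0 // => k; rewrite eq_sym => /negPf->.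
under eq_bigr do rewrite big_mkcond.
rewrite exchange_big big_seq big1 //= => k.
rewrite mem_undup => /mapP[t /L0 + ->]; rewrite key_coefE => /eqP t0.
by rewrite -big_mkcond -mulr_suml -rmorph_sum t0 mul0r.
Qed.

Lemma lop_eq L L' f w : lpoly_eq L L' -> lop L f w = lop L' f w.
Proof.
move=> /(lop_zero _ f w); rewrite lop_cat lop_scale mulr1 => /eqP.
by rewrite mulN1r subr_eq0 => /eqP.
Qed.

End LaurentOperators.

(** * Leading exponents *)

Section LeadingExponents.

(* With these weights each of the operators below has a unique monomial of top weight. *)
Definition weight (v : expo) : int :=
  let: (i, a, b, c, e, y) := v in 6 * i + 4 * a + 4 * b + 4 * c + 3 * e.

Arguments weight : simpl never.

Lemma weightD u v : weight (u + v) = weight u + weight v.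
Proof.
by case: u v => [[[[[i a] b] c] e] y] [[[[[i' a'] b'] c'] e'] y']; rewrite /weight; ring.
Qed.

Lemma weightB u v : weight (u - v) = weight u - weight v.
Proof. by rewrite -[in RHS](subrK v u) [in RHS]weightD addrK. Qed.

Variables (F : fieldType) (q : F).
Hypothesis hq0 : q != 0.

Definition leads_at (f : expo -> F) (u : expo) : Prop :=
  f u != 0 /\ forall w, f w != 0 -> w = u \/ weight w < weight u.

Lemma leads_at_ext f g u : f =1 g -> leads_at f u -> leads_at g u.
Proof. by move=> fg [fu fP]; split=> [|w]; rewrite -fg //; apply: fP. Qed.

(** A head coefficient 1 or -1 is nonzero in every characteristic. *)
Definition lead_term (L : lpoly) (v : expo) : bool :=
  if L is t :: L' then
    [&& (t.1 == 1) || (t.1 == -1), t.2.2 == v & all (fun t' => weight t'.2.2 < weight v) L']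
  else false.

(** Weights add, and only the head of [L] reaches [u + v]: a lighter term would need a nonzero value
    of [f] at an exponent heavier than [u]. *)
Lemma leads_at_lop L v f u :
  lead_term L v -> leads_at f u -> leads_at (lop F q L f) (u + v).
Proof.
case: L => [|t L] //= /and3P[t1 /eqP tv /allP Lv] [fu fP]; split.
  rewrite /lop big_cons tv big_seq big1 ?addr0 => [|[n [p v']] /Lv/= ltv].
    rewrite !mulf_neq0 ?expfz_neq0 ?addrK //.
    by case/orP: t1 => /eqP->; rewrite ?oppr_eq0 oner_eq0.
  have [->|/fP[eq_u|]] := eqVneq (f (u + v - v')) 0; first by rewrite !mulr0.
    by exfalso; move: (congr1 weight eq_u); rewrite weightB weightD; lia.
  by rewrite weightB weightD => ltu; exfalso; lia.
move=> w fw.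
(* A nonzero value at [w] comes from some term v' of [L] with f(w - v') nonzero. *)
have /hasP[[n [p v']] vL /= /fP] : has (fun t' => f (w - t'.2.2) != 0) (t :: L).
  apply: contraR fw => /hasPn f0; rewrite /lop big_seq big1 // => t' /f0 /negbNE/eqP->.
  by rewrite !mulr0.
have -> : weight w = weight (w - v') + weight v' by rewrite -weightD subrK.
rewrite (weightD u v); move: vL; rewrite inE => /predU1P[eq_t|/Lv/= ltv].
  by rewrite -tv -eq_t => -[<-|ltu]; [left; rewrite subrK|right; rewrite ltrD2r].
by case=> [->|/ltW leu]; right; apply: ler_ltD.
Qed.

End LeadingExponents.

(** * Top exponents of the basis monomials and images of the generators *)

Definition mono_expo (e : AW_index) : expo :=
  let: (i, j, k, l, r, s, t) := e in
  ((k + l + r + s + t)%:Z, (i + l + r)%:Z, (j + l + s)%:Z, (k + l + t)%:Z,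
   i%:Z - k%:Z, j%:Z - k%:Z).

(** The last two entries give i - k and j - k; since ijk = 0 means min(i, j, k) = 0, they determine
    i, j, k. Then l + r, l + s, l + t and l + r + s + t are known; the first three minus the last
    sum to 2l, which gives l and so r, s, t. *)
Lemma mono_expo_inj e e' :
  AW_admissible e -> AW_admissible e' -> mono_expo e = mono_expo e' -> e = e'.
Proof.
case: e e' => [[[[[[i j] k] l] r] s] t] [[[[[[i' j'] k'] l'] r'] s'] t'].
rewrite /AW_admissible !muln_eq0 => adm adm' [].
move=> h1 h2 h3 h4 h5 h6.
have [ei ej ek] : [/\ i = i', j = j' & k = k'] by split; lia.
by subst; do !congr (_, _); lia.
Qed.

(* With x = y^-1 + e, z = y^-1 + g e^-1 and g = 1 - q^-1 Lambda y^-1 + q^-2 y^-2, the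
   next three lists are a x + a^-1 y + q (b/c) (1 - x y) and its images under
   (a, b, c, x, y, z) -> (b, c, a, y, z, x) -> (c, a, b, z, x, y), leading term first. *)
Definition AL : lpoly :=
  [:: qmon 1 0 0 1 0 0 1 0;
      qmon 1 0 0 1 0 0 0 (-1);
      qmon (-1) 1 0 0 1 (-1) 1 1;
      qmon 1 0 0 (-1) 0 0 0 1].
Definition BL : lpoly :=
  [:: qmon 1 0 0 0 1 0 0 1;
      qmon 1 0 1 (-1) 0 1 (-1) 0;
      qmon (-1) 1 1 0 (-1) 0 (-1) (-1);
      qmon (-1) (-1) 0 (-1) 0 1 (-1) 1;
      qmon (-1) 1 0 (-1) 0 1 (-1) (-1);
      qmon 1 0 0 0 (-1) 0 0 (-1);
      qmon 1 0 0 0 (-1) 0 (-1) 0;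
      qmon 1 2 0 0 (-1) 0 (-1) (-2)].
Definition CL : lpoly :=
  [:: qmon (-1) 1 1 0 0 1 (-1) (-1);
      qmon 1 0 1 1 (-1) 0 0 (-1);
      qmon 1 0 0 0 0 1 0 (-1);
      qmon (-1) (-1) 0 1 (-1) 0 1 (-1);
      qmon 1 2 1 1 (-1) 0 (-1) (-2);
      qmon 1 0 0 0 0 1 (-1) 0;
      qmon 1 2 0 0 0 1 (-1) (-2);
      qmon (-1) 1 0 1 (-1) 0 0 (-2);
      qmon (-1) (-1) 0 1 (-1) 0 0 (-2);
      qmon 1 0 0 0 0 (-1) 1 0;
      qmon (-1) 1 0 1 (-1) 0 (-1) (-1);
      qmon (-1) 3 0 1 (-1) 0 (-1) (-3);
      qmon 1 0 0 0 0 (-1) 0 (-1)].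
Definition alphaL : lpoly :=
  [:: qmon 1 0 1 1 0 0 0 0;
      qmon 1 0 0 0 1 1 0 0;
      qmon 1 0 1 (-1) 0 0 0 0;
      qmon 1 0 0 0 1 (-1) 0 0;
      qmon 1 0 0 0 (-1) 1 0 0;
      qmon 1 0 0 0 (-1) (-1) 0 0].
Definition betaL : lpoly :=
  [:: qmon 1 0 1 0 1 0 0 0;
      qmon 1 0 0 1 0 1 0 0;
      qmon 1 0 1 0 (-1) 0 0 0;
      qmon 1 0 0 1 0 (-1) 0 0;
      qmon 1 0 0 (-1) 0 1 0 0;
      qmon 1 0 0 (-1) 0 (-1) 0 0].
Definition gammaL : lpoly :=
  [:: qmon 1 0 1 0 0 1 0 0;
      qmon 1 0 0 1 1 0 0 0;
      qmon 1 0 1 0 0 (-1) 0 0;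
      qmon 1 0 0 1 (-1) 0 0 0;
      qmon 1 0 0 (-1) 1 0 0 0;
      qmon 1 0 0 (-1) (-1) 0 0 0].
(** Expansion of (q + q^-1)^2 - Lambda^2 - (a + a^-1)^2 - (b + b^-1)^2 - (c + c^-1)^2 - Lambda (a +
    a^-1) (b + b^-1) (c + c^-1), leading term first. *)
Definition OmegaL : lpoly :=
  [:: qmon (-1) 0 1 1 1 1 0 0;
      qmon (-1) 0 2 0 0 0 0 0;
      qmon (-1) 0 1 1 (-1) 1 0 0;
      qmon (-1) 0 1 1 1 (-1) 0 0;
      qmon (-1) 0 1 (-1) 1 1 0 0;
      qmon (-1) 0 0 2 0 0 0 0;
      qmon (-1) 0 0 0 0 2 0 0;
      qmon (-1) 0 0 0 2 0 0 0;
      qmon (-1) 0 1 (-1) (-1) 1 0 0;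
      qmon (-1) 0 1 1 (-1) (-1) 0 0;
      qmon (-1) 0 1 (-1) 1 (-1) 0 0;
      qmon 1 2 0 0 0 0 0 0;
      qmon (-4) 0 0 0 0 0 0 0;
      qmon 1 (-2) 0 0 0 0 0 0;
      qmon (-1) 0 1 (-1) (-1) (-1) 0 0;
      qmon (-1) 0 0 0 (-2) 0 0 0;
      qmon (-1) 0 0 (-2) 0 0 0 0;
      qmon (-1) 0 0 0 0 (-2) 0 0].

Definition gen_lpoly (i : 'I_3) : lpoly := nth [::] [:: AL; BL; CL] i.

(** The definition of alpha multiplied by q - q^-1 = (q^2 - q^-2)/(q + q^-1), which clears the
    denominators. *)
Definition ctr_relation (X Y Z L : lpoly) : bool :=
  lpoly_eq (lscale 1 2 X ++ lscale (-1) (-2) X ++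
             lscale 1 1 (lmul Y Z) ++ lscale (-1) (-1) (lmul Z Y))
            (lscale 1 1 L ++ lscale (-1) (-1) L).

Definition lcomm (L L' : lpoly) : bool := lpoly_eq (lmul L L') (lmul L' L).

Definition Omega_relation (X Y Z X' Y' Z' L : lpoly) : bool :=
  lpoly_eq (lscale 1 1 (lmul (lmul X Y) Z) ++ lscale 1 2 (lmul X X) ++
             lscale 1 (-2) (lmul Y Y) ++ lscale 1 2 (lmul Z Z) ++
             lscale (-1) 1 (lmul X X') ++ lscale (-1) (-1) (lmul Y Y') ++
             lscale (-1) 1 (lmul Z Z')) L.

Lemma ctr_relations :
  [&& ctr_relation AL BL CL alphaL, ctr_relation BL CL AL betaL
    & ctr_relation CL AL BL gammaL].
Proof. by vm_compute. Qed.

Lemma central_relations :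
  all (fun L => all (lcomm L) [:: AL; BL; CL]) [:: alphaL; betaL; gammaL].
Proof. by vm_compute. Qed.

Lemma Omega_relationP : Omega_relation AL BL CL alphaL betaL gammaL OmegaL.
Proof. by vm_compute. Qed.

(** * Algebra elements represented by torus operators *)

Section TorusRepresentation.
Variables (F : fieldType) (q : F) (M : monomType).
Hypotheses (hq0 : q != 0) (hq4 : q ^+ 4 != 1).
Variable act : M -> (expo -> F) -> expo -> F.
Hypotheses
  (actM : forall m n f, act (mmul m n) f =1 act m (act n f))
  (act1 : forall f, act mone f =1 f)
  (act_sum : forall m (s : seq M) (c : M -> F) (f : M -> expo -> F) w,
    act m (fun u => \sum_(x <- s) c x * f x u) w = \sum_(x <- s) c x * act m (f x) w).

Local Notation rho := (malg_act F M expo act).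

Definition represents (p : {malg F[M]}) (L : lpoly) :=
  forall f, rho p f =1 lop F q L f.

Lemma representsM p p' L L' :
  represents p L -> represents p' L' -> represents (p * p') (lmul L L').
Proof.
move=> pL p'L' f w; rewrite malg_actM // pL lop_mul //.
by apply: lop_ext; apply: p'L'.
Qed.

Lemma represents_ctr x y z X Y Z L :
  represents x X -> represents y Y -> represents z Z -> ctr_relation X Y Z L ->
  represents ((q + q^-1) *:
    (x + (q ^+ 2 - q ^- 2)^-1 *: (q *: (y * z) - q^-1 *: (z * y)))) L.
Proof.
move=> xX yY zZ /(lop_eq F q hq0) rel f w; have {rel} := rel f w.
rewrite !lop_cat !lop_scale // !mulrN1z mulr1z !mul1r !mulN1r => rel.
have yzE := representsM _ _ _ _ yY zZ f w; have zyE := representsM _ _ _ _ zZ yY f w.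
rewrite !(malg_actZ, malg_actD, malg_actN) xX {}yzE {}zyE.
have D0 := q2BVq2_neq0 F q hq0 hq4.
apply: (mulfI D0); rewrite mulrCA mulrDr mulVKf //.
(* q^2 - q^-2 = (q + q^-1)(q - q^-1), and the second factor is the one in [rel]. *)
transitivity ((q + q^-1) * (q ^ 1 * lop F q L f w + - q ^ (-1) * lop F q L f w)).
  by rewrite -rel -[q ^ 2]/(q ^+ 2) -[q ^ (-2)]/(q ^- 2) -[q ^ 1]/q -[q ^ (-1)]/(q^-1); ring.
by rewrite -[q ^ 1]/q -[q ^ (-1)]/(q^-1); field.
Qed.

(** Only [k *: x] is known to act as [L], so the commutator is multiplied by the nonzero [k]. *)
Lemma rho_comm k x g L G : (forall f w, rho (k *: x) f w = lop F q L f w) -> k != 0 ->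
  represents g G -> lcomm L G -> forall f w, rho (x * g - g * x) f w = 0.
Proof.
move=> xL k0 gG /(lop_eq F q hq0) LG f w; apply: (mulfI k0).
rewrite mulr0 malg_actD malg_actN !malg_actM // mulrDr mulrN -malg_actZ xL gG -lopZ.
have -> : lop F q L (rho g f) w = lop F q (lmul L G) f w.
  by rewrite lop_mul //; apply: lop_ext; apply: gG.
have -> : lop F q G (fun u => k * rho x f u) w = lop F q (lmul G L) f w.
  by rewrite lop_mul //; apply: lop_ext => u; rewrite -malg_actZ xL.
by rewrite LG subrr.
Qed.

Lemma represents_Omega x y z x' y' z' X Y Z X' Y' Z' L :
  represents x X -> represents y Y -> represents z Z ->
  represents x' X' -> represents y' Y' -> represents z' Z' ->
  Omega_relation X Y Z X' Y' Z' L ->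
  represents (q *: (x * y * z) + q ^+ 2 *: (x * x) + q ^- 2 *: (y * y)
    + q ^+ 2 *: (z * z) - q *: (x * x') - q^-1 *: (y * y') - q *: (z * z')) L.
Proof.
move=> AP BP CP alP beP gaP /(lop_eq F q hq0) rel f w; rewrite -{}rel.
rewrite !lop_cat !lop_scale // !mulrN1z mulr1z !mul1r !mulN1r.
have addE p p' c d : rho p f w = c -> rho p' f w = d -> rho (p + p') f w = c + d.
  by move=> <- <-; apply: malg_actD.
have subE p p' c d : rho p f w = c -> rho p' f w = d -> rho (p - p') f w = c - d.
  by move=> <- <-; rewrite malg_actD malg_actN.
have scaleE k p c : rho p f w = c -> rho (k *: p) f w = k * c.
  by move=> <-; apply: malg_actZ.
have prodE p p' A B (pA : represents p A) (p'B : represents p' B) :=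
  representsM p p' A B pA p'B f w.
apply: etrans (subE _ _ _ _ (subE _ _ _ _ (subE _ _ _ _ (addE _ _ _ _ (addE _ _ _ _
  (addE _ _ _ _ (scaleE q _ _ (prodE _ _ _ _ (representsM _ _ _ _ AP BP) CP))
    (scaleE _ _ _ (prodE _ _ _ _ AP AP))) (scaleE _ _ _ (prodE _ _ _ _ BP BP)))
    (scaleE _ _ _ (prodE _ _ _ _ CP CP))) (scaleE _ _ _ (prodE _ _ _ _ AP alP)))
    (scaleE _ _ _ (prodE _ _ _ _ BP beP))) (scaleE _ _ _ (prodE _ _ _ _ CP gaP))) _.
by rewrite !mulNr !addrA.
Qed.

(** Quantifying over all [f] makes leading exponents add under products. *)
Definition leads (p : {malg F[M]}) (v : expo) :=
  forall f u, leads_at F f u -> leads_at F (rho p f) (u + v).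

Lemma leads_represents p L v : represents p L -> lead_term L v -> leads p v.
Proof.
move=> pL Lv f u fu; apply: (leads_at_ext F (lop F q L f)); first exact/fsym/pL.
exact: leads_at_lop.
Qed.

Lemma leadsM p p' v v' : leads p v -> leads p' v' -> leads (p * p') (v + v').
Proof.
move=> pv p'v' f u fu; rewrite [v + v']addrC addrA.
by apply: leads_at_ext (pv _ _ (p'v' _ _ fu)) => w; rewrite malg_actM.
Qed.

Lemma leads_exp p v n : leads p v -> leads (p ^+ n) (v *+ n).
Proof.
move=> pv; elim: n => [|n IHn]; last by rewrite exprS mulrS; apply: leadsM.
move=> f u fu; rewrite addr0; apply: leads_at_ext fu => w.
by rewrite malg_act_1.
Qed.

End TorusRepresentation.

(** * Linear independence from distinct leading exponents *)

Lemma seq_argmax (T : eqType) (h : T -> int) (s : seq T) x0 : x0 \in s ->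
  exists2 x, x \in s & forall y, y \in s -> h y <= h x.
Proof.
elim: s x0 => // x [|y s] IHs x0 _; first by exists x; rewrite ?mem_head // => z /[!inE]/eqP->.
have [z zs zmax] := IHs y (mem_head _ _); case: (leP (h z) (h x)) => hzx.
  by exists x; rewrite ?mem_head // => t /predU1P[->//|/zmax/le_trans]; apply.
exists z; first by rewrite in_cons zs orbT.
by move=> t /predU1P[->|/zmax//]; apply: ltW.
Qed.

(** Among the indices with nonzero coefficient, take one of maximal weight and evaluate the sum at
    its leading exponent: every other term vanishes there. *)
Lemma leads_at_independent (F : fieldType) (T : eqType) (s : seq T) (c : T -> F)
    (g : T -> expo -> F) (v : T -> expo) :
  uniq s -> {in s &, injective v} -> (forall e, e \in s -> leads_at F (g e) (v e)) ->
  (forall w, \sum_(e <- s) c e * g e w = 0) -> forall e, e \in s -> c e = 0.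
Proof.
move=> s_uniq v_inj gv sum0 e0 e0s; apply: contraTeq isT => ce0.
have e0s' : e0 \in [seq e <- s | c e != 0] by rewrite mem_filter ce0.
have [e + emax] := seq_argmax _ (weight \o v) _ _ e0s'.
rewrite mem_filter => /andP[ce es].
have /eqP := sum0 (v e); rewrite (bigD1_seq e) //= big_seq_cond big1.
  by rewrite addr0 mulf_eq0 (negPf ce) (negPf (gv e es).1).
move=> e' /andP[e's ne]; have [->|ce'] := eqVneq (c e') 0; first by rewrite mul0r.
have [->|/(gv e' e's).2[/v_inj eq_e|]] := eqVneq (g e' (v e)) 0; first by rewrite mulr0.
  by rewrite eq_e ?eqxx // in ne.
have : e' \in [seq e <- s | c e != 0] by rewrite mem_filter ce'.
by move/emax => /=; rewrite leNgt => /negP.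
Qed.

(** * Independence in the universal Askey-Wilson algebra *)

Section Independence.
Variables (F : fieldType) (q : F).
Hypotheses (hq0 : q != 0) (hq4 : q ^+ 4 != 1).

(** The free monoid acts by composing the operators of the letters; that the relations act as zero
    is [rho_rels]. *)
Definition word_act (m : {fmonom 'I_3}) (f : expo -> F) : expo -> F :=
  foldr (fun i => lop F q (gen_lpoly i)) f (fmonom_val m).

Lemma word_act_ext m f g : f =1 g -> word_act m f =1 word_act m g.
Proof.
rewrite /word_act => fg; elim: (fmonom_val m) => [|i s IHs] //=.
exact: lop_ext.
Qed.

Lemma word_actM m n f : word_act (mmul m n) f =1 word_act m (word_act n f).
Proof. by move=> w; rewrite /word_act fmM foldr_cat. Qed.

Lemma word_act1 f : word_act mone f =1 f.
Proof. by move=> w; rewrite /word_act fm1. Qed.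

Lemma word_act_sum m (s : seq {fmonom 'I_3}) (c : {fmonom 'I_3} -> F)
    (f : {fmonom 'I_3} -> expo -> F) w :
  word_act m (fun u => \sum_(x <- s) c x * f x u) w =
  \sum_(x <- s) c x * word_act m (f x) w.
Proof.
rewrite /word_act; elim: (fmonom_val m) w => [|i t IHt] w //=.
by rewrite (lop_ext _ _ _ _ _ IHt) lop_sum.
Qed.

Local Notation rho := (malg_act F {fmonom 'I_3} expo word_act).
Local Notation represents := (represents F q {fmonom 'I_3} word_act).
Local Notation leads := (leads F {fmonom 'I_3} word_act).

Lemma represents_gen i : represents (gen F i) (gen_lpoly i).
Proof. by move=> f w; rewrite malg_actU mul1r /word_act fmU. Qed.

Let repA : represents (gA F) AL := represents_gen 0.
Let repB : represents (gB F) BL := represents_gen 1.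
Let repC : represents (gC F) CL := represents_gen 2.

Let rep_ctr := represents_ctr F q {fmonom 'I_3} hq0 hq4 _ word_actM word_act_sum.

Lemma represents_alpha : represents (alpha q) alphaL.
Proof. by apply: (rep_ctr _ _ _ _ _ _ _ repA repB repC); case/and3P: ctr_relations. Qed.

Lemma represents_beta : represents (beta q) betaL.
Proof. by apply: (rep_ctr _ _ _ _ _ _ _ repB repC repA); case/and3P: ctr_relations. Qed.

Lemma represents_gamma : represents (gamma q) gammaL.
Proof. by apply: (rep_ctr _ _ _ _ _ _ _ repC repA repB); case/and3P: ctr_relations. Qed.

Lemma represents_OmegaL : represents (Omega q) OmegaL.
Proof.
exact: (represents_Omega F q {fmonom 'I_3} hq0 _ word_actM word_act_sum
  _ _ _ _ _ _ _ _ _ _ _ _ _ repA repB repC represents_alpha represents_beta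
  represents_gamma Omega_relationP).
Qed.

Lemma rho_rels r f w : r \in AW_rels q -> rho r f w = 0.
Proof.
have ctrP x : x \in [:: ctrA q; ctrB q; ctrC q] ->
    exists2 L, L \in [:: alphaL; betaL; gammaL] & represents ((q + q^-1) *: x) L.
  rewrite !in_cons in_nil => /or4P[|||//] /eqP->.
  - by exists alphaL; [exact: mem_head|exact: represents_alpha].
  - by exists betaL; [rewrite in_cons mem_head orbT|exact: represents_beta].
  - by exists gammaL; [rewrite 2!in_cons mem_head !orbT|exact: represents_gamma].
have genP g : g \in [:: gA F; gB F; gC F] ->
    exists2 G, G \in [:: AL; BL; CL] & represents g G.
  rewrite !in_cons in_nil => /or4P[|||//] /eqP->.
  - by exists AL; [exact: mem_head|exact: repA].
  - by exists BL; [rewrite in_cons mem_head orbT|exact: repB].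
  - by exists CL; [rewrite 2!in_cons mem_head !orbT|exact: repC].
case/allpairsP => -[x g] /= [/ctrP[L Lin xL] /genP[G Gin gG] ->].
have /allP/(_ _ Gin) LG := allP central_relations _ Lin.
exact: (rho_comm F q {fmonom 'I_3} hq0 _ word_actM word_act_sum _ _ _ _ _ xL
  (qDVq_neq0 F q hq0 hq4) gG LG).
Qed.

Lemma rho_ideal p f w : in_AW_ideal q p -> rho p f w = 0.
Proof.
apply: (malg_act_ideal F {fmonom 'I_3} expo word_act word_act_ext word_actM
  word_act_sum (AW_rels q) p f w) => r g u.
exact: rho_rels.
Qed.

Lemma leads_AW_mono e : leads (AW_mono q e) (mono_expo e).
Proof.
have lead L p v := leads_represents F q {fmonom 'I_3} hq0 word_act p L v.
have lA : leads (gA F) (0, 1, 0, 0, 1, 0) by apply: (lead _ _ _ repA).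
have lB : leads (gB F) (0, 0, 1, 0, 0, 1) by apply: (lead _ _ _ repB).
have lC : leads (gC F) (1, 0, 0, 1, -1, -1) by apply: (lead _ _ _ repC).
have lO : leads (Omega q) (1, 1, 1, 1, 0, 0) by apply: (lead _ _ _ represents_OmegaL).
have la : leads (alpha q) (1, 1, 0, 0, 0, 0) by apply: (lead _ _ _ represents_alpha).
have lb : leads (beta q) (1, 0, 1, 0, 0, 0) by apply: (lead _ _ _ represents_beta).
have lc : leads (gamma q) (1, 0, 0, 1, 0, 0) by apply: (lead _ _ _ represents_gamma).
case: e => [[[[[[i j] k] l] r] s] t].
have mulX := leads_exp F {fmonom 'I_3} word_act word_actM word_act1 word_act_sum.
have mulM := leadsM F {fmonom 'I_3} word_act word_actM word_act_sum.
have := mulM _ _ _ _ (mulM _ _ _ _ (mulM _ _ _ _ (mulM _ _ _ _ (mulM _ _ _ _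
  (mulM _ _ _ _ (mulX _ _ i lA) (mulX _ _ j lB)) (mulX _ _ k lC)) (mulX _ _ l lO))
  (mulX _ _ r la)) (mulX _ _ s lb)) (mulX _ _ t lc).
set v := (X in leads _ X); have -> : v = mono_expo (i, j, k, l, r, s, t); last exact.
have expo_mulrn (a b c d e y : int) n :
  ((a, b, c, d, e, y) : expo) *+ n = (a *+ n, b *+ n, c *+ n, d *+ n, e *+ n, y *+ n).
  by elim: n => [|n IHn] //; rewrite !mulrS IHn.
rewrite {}/v !expo_mulrn !mul0rn !mulNrn /mono_expo.
do ![congr (_, _)]; rewrite /= ?natz; lia.
Qed.

(** This function is the series 1; applying [AW_mono q e] to it produces the leading exponent
    [mono_expo e]. *)
Lemma leads_at_delta : leads_at F (fun w => (w == 0)%:R) 0.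
Proof.
split=> [|w]; first by rewrite eqxx oner_eq0.
by case: (w =P 0) => [->|_]; [left|rewrite eqxx].
Qed.

Theorem AW_mono_independent (s : seq AW_index) (c : AW_index -> F) :
  uniq s -> (forall e, e \in s -> AW_admissible e) ->
  in_AW_ideal q (\sum_(e <- s) c e *: AW_mono q e) ->
  forall e, e \in s -> c e = 0.
Proof.
move=> s_uniq s_adm /rho_ideal Is.
pose g e := rho (AW_mono q e) (fun w => (w == 0)%:R).
apply: (leads_at_independent F _ s c g mono_expo s_uniq) => [e e' /s_adm ? /s_adm ?|e es|w].
- exact: mono_expo_inj.
- by have := leads_AW_mono e _ _ leads_at_delta; rewrite add0r.
(* The combination lies in the ideal, hence acts as zero on the series 1. *)
apply: etrans (Is (fun w => (w == 0)%:R) w); rewrite malg_act_sum.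
by apply: eq_bigr => e _; rewrite malg_actZ.
Qed.

End Independence.

(* Delta = FreeAlg F / (two-sided ideal generated by AW_rels q).
   The images of AW_mono q e (e admissible) form a basis of Delta:
   they span Delta, and they are linearly independent in Delta. *)
Theorem theorem7p5 (F : fieldType) (q : F) (hq0 : q != 0) (hq4 : q ^+ 4 != 1) :
  (forall p : FreeAlg F,
     exists s : seq (F * AW_index),
       (forall x, x \in s -> AW_admissible x.2) /\
       in_AW_ideal q (p - \sum_(x <- s) x.1 *: AW_mono q x.2))
  /\
  (forall (s : seq AW_index) (c : AW_index -> F),
     uniq s -> (forall e, e \in s -> AW_admissible e) ->
     in_AW_ideal q (\sum_(e <- s) c e *: AW_mono q e) ->
     forall e, e \in s -> c e = 0).
Proof.
split; first exact: AW_mono_span.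
exact: AW_mono_independent.
Qed.
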